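(* Let $G$ be a triangle-free graph of order $n\geq 4$. Then $PRC(G)=n$ if and only if $G\in\mathcal{T}_1\cup\mathcal{T}_2$, where $\mathcal{T}_1$ is the family of graphs $K_{r,r}-M$ with $r\geq 2$ and $M$ a perfect matching of $K_{r,r}$, and $\mathcal{T}_2$ is the family of graphs $K_{r,s}-M$ with $r,s\geq 2$ and $M$ a (possibly empty) matching of $K_{r,s}$ with $|M|<\min\{r,s\}$.
   Context: All graphs are simple, finite and undirected; $K_{r,s}$ is the complete bipartite graph with parts of sizes $r,s$, and $H-M$ denotes deleting the edge set $M$ from $H$. A set $S\subseteq V(G)$ is a dominating set if every vertex not in $S$ has a neighbor in $S$; $S$ is a perfect dominating set if every vertex in $V(G)\setminus S$ has exactly one neighbor in $S$. A perfect coalition in $G$ consists of two disjoint sets $V_1,V_2$ of vertices such that (i) neither $V_1$ nor $V_2$ is a dominating set of $G$; (ii) each vertex in $V(G)\setminus V_1$ has at most one neighbor in $V_1$, and each vertex in $V(G)\setminus V_2$ has at most one neighbor in $V_2$; (iii) $V_1\cup V_2$ is a perfect dominating set of $G$. A perfect coalition partition ($prc$-partition) of $G$ is a vertex partition $\pi=\{V_1,\dots,V_k\}$ such that each $V_i$ either is a singleton dominating set or forms a perfect coalition with some $V_j\in\pi$. $PRC(G)$ is the maximum cardinality of a $prc$-partition of $G$, with $PRC(G)=0$ if $G$ has no $prc$-partition. *)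

(* Defs.v *)
From mathcomp Require Import all_boot.

Set Implicit Arguments.
Unset Strict Implicit.
Unset Printing Implicit Defensive.

Record sgraph := SGraph {
  vertex :> finType;
  adj : rel vertex;
  adj_sym : symmetric adj;
  adj_irr : irreflexive adj
}.

Definition isomorphic (G H : sgraph) : Prop :=
  exists2 f : G -> H, bijective f & forall x y, adj (f x) (f y) = adj x y.

Section Graph.
Variable G : sgraph.
Implicit Types (x y z : G) (S A B : {set G}) (P M : {set {set G}}).

Definition triangle_free : Prop :=
  forall x y z, ~ [/\ adj x y, adj y z & adj x z].

Definition nbhd x : {set G} := [set y | adj x y].

Definition dominating S : bool :=
  [forall (x | x \notin S), exists y in S, adj x y].

Definition perfect_dominating S : bool :=
  [forall (x | x \notin S), #|nbhd x :&: S| == 1].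

Definition perfect_coalition A B : bool :=
  [&& [disjoint A & B],
      ~~ dominating A && ~~ dominating B,
      [forall (x | x \notin A), #|nbhd x :&: A| <= 1],
      [forall (x | x \notin B), #|nbhd x :&: B| <= 1]
    & perfect_dominating (A :|: B)].

Definition prc_partition P : bool :=
  partition P [set: G] &&
  [forall (A | A \in P),
     (#|A| == 1) && dominating A || [exists B in P, perfect_coalition A B]].

(* A \max over an empty range is 0, as required when no prc-partition exists. *)
Definition PRC : nat := \max_(P : {set {set G}} | prc_partition P) #|P|.

Definition edges : {set {set G}} :=
  [set [set p.1; p.2] | p : G * G & adj p.1 p.2].

Definition matching M : bool := (M \subset edges) && trivIset M.

Definition perfect_matching M : bool := matching M && (cover M == [set: G]).

Definition del_rel M : rel G := [rel x y | adj x y && ([set x; y] \notin M)].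

Lemma del_rel_sym M : symmetric (del_rel M).
Proof. by move=> x y; rewrite /del_rel /= adj_sym setUC. Qed.

Lemma del_rel_irr M : irreflexive (del_rel M).
Proof. by move=> x; rewrite /del_rel /= adj_irr. Qed.

Definition del_edges M : sgraph := SGraph (@del_rel_sym M) (@del_rel_irr M).

End Graph.

Section CompleteBipartite.
Variables r s : nat.

Definition Krs_rel : rel ('I_r + 'I_s) :=
  fun x y => match x, y with
             | inl _, inr _ | inr _, inl _ => true
             | _, _ => false
             end.

Lemma Krs_rel_sym : symmetric Krs_rel.
Proof. by move=> [x|x] [y|y]. Qed.

Lemma Krs_rel_irr : irreflexive Krs_rel.
Proof. by move=> [x|x]. Qed.

Definition Krs : sgraph := SGraph Krs_rel_sym Krs_rel_irr.

End CompleteBipartite.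

Definition family_T1 (G : sgraph) : Prop :=
  exists (r : nat) (M : {set {set Krs r r}}),
    [/\ 2 <= r, perfect_matching M & isomorphic G (del_edges M)].

Definition family_T2 (G : sgraph) : Prop :=
  exists (r s : nat) (M : {set {set Krs r s}}),
    [/\ 2 <= r, 2 <= s, matching M, #|M| < minn r s
      & isomorphic G (del_edges M)].

(* Main.v *)
(* PRC(G) = n means that the partition into singletons is a prc-partition. No
   vertex is universal when G is triangle-free with n >= 4, so every vertex x has
   a partner y such that each further vertex is adjacent to exactly one of x, y.
   Since neighbourhoods are independent, one such pair already gives the
   bipartition N(x) + y, N(y) + x, and then every vertex turns out to have a
   partner on the other side, the two being adjacent to all vertices opposite to
   them except possibly each other. So G is K_{r,s} minus a matching M in which
   every unmatched vertex has an unmatched vertex across from it; as |M| counts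
   the matched vertices of either side, this says that M is perfect or
   |M| < min(r, s). *)
Require Import Defs.
From mathcomp Require Import all_boot.

Set Implicit Arguments.
Unset Strict Implicit.
Unset Printing Implicit Defensive.

Lemma fresh (T : finType) (s : seq T) : size s < #|T| -> exists x, x \notin s.
Proof.
move=> lt_sT; apply/existsP; apply: contraLR lt_sT.
rewrite negb_exists -leqNgt => /forallP Ts.
apply: leq_trans (card_size s); rewrite subset_leq_card //.
by apply/subsetP => x _; have := Ts x; rewrite negbK.
Qed.

Lemma bool_neq_trans (a b c : bool) : a != b -> b != c -> a = c.
Proof. by case: a b c => [] [] []. Qed.

Lemma set2_inj (T : finType) (x y a b : T) :
  [set x; y] = [set a; b] -> x = a /\ y = b \/ x = b /\ y = a.
Proof.
move=> E; have xab : x \in [set a; b] by rewrite -E set21.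
have yab : y \in [set a; b] by rewrite -E set22.
have axy : a \in [set x; y] by rewrite E set21.
have bxy : b \in [set x; y] by rewrite E set22.
move: xab yab axy bxy; do 4 (case/set2P=> ?); subst; by auto.
Qed.

(** * Perfect coalitions between single vertices *)

Section Coalitions.
Variable G : sgraph.
Implicit Types (x y z u v w : G) (P : {set {set G}}).

Definition universal x : bool := [forall (y | y != x), adj x y].

(** This is [perfect_coalition] on two singletons: the at-most-one-neighbor conditions become
    trivial, domination becomes universality, and exactly one neighbor becomes exclusive or. *)
Definition coalition x y : Prop :=
  [/\ x != y, ~~ universal x, ~~ universal y
    & forall z, z != x -> z != y -> adj z x (+) adj z y].

Lemma coalition_sym x y : coalition x y -> coalition y x.
Proof.
case=> xy nx ny H; split=> //; first by rewrite eq_sym.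
by move=> z zy zx; rewrite addbC H.
Qed.

Lemma dominating1 x : dominating [set x] = universal x.
Proof.
apply/forall_inP/forall_inP => H y.
  move=> yx; have /H/exists_inP[z /set1P-> ] : y \notin [set x] by rewrite inE.
  by rewrite adj_sym.
rewrite inE => /H xy; apply/exists_inP; exists x; first exact: set11.
by rewrite adj_sym.
Qed.

Lemma card_nbhd_set2 x y z :
  x != y -> #|nbhd z :&: [set x; y]| = adj z x + adj z y.
Proof.
move=> xy; rewrite -sum1_card.
under eq_bigl do rewrite inE andbC.
rewrite big_mkcondr big_setU1 ?inE //= big_set1 !inE.
by do 2 case: (adj _ _).
Qed.

Lemma perfect_coalition1 x y :
  reflect (coalition x y) (perfect_coalition [set x] [set y]).
Proof.
have small u : [forall (z | z \notin [set u]), #|nbhd z :&: [set u]| <= 1].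
  apply/forall_inP => z _; rewrite -(cards1 u) subset_leq_card //.
  exact: subsetIr.
rewrite /perfect_coalition !small !dominating1 disjoints1 inE /=.
apply: (iffP and3P) => [[xy /andP[nx ny] /forall_inP H]|[xy nx ny H]].
  split=> // z zx zy; have := H z; rewrite !inE negb_or zx zy => /(_ isT).
  by rewrite card_nbhd_set2 //; do 2 case: (adj _ _).
split; rewrite ?nx ?ny //; apply/forall_inP => z.
rewrite !inE negb_or => /andP[zx zy]; rewrite card_nbhd_set2 //.
by have := H z zx zy; do 2 case: (adj _ _).
Qed.

(** * The partition into singletons and [PRC] *)

Definition singletons : {set {set G}} := [set [set x] | x in G].

Lemma card_singletons : #|singletons| = #|G|.
Proof. by rewrite card_imset //; apply: set1_inj. Qed.

Lemma partition_singletons : partition singletons [set: G].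
Proof.
apply/and3P; split.
- rewrite eqEsubset subsetT; apply/subsetP => x _.
  by apply/bigcupP; exists [set x]; rewrite ?set11 // imset_f.
- apply/trivIsetP => _ _ /imsetP[x _ ->] /imsetP[y _ ->] xy.
  by rewrite disjoints1 inE; apply: contra xy => /eqP->.
- by apply/imsetP => -[x _ /setP/(_ x)]; rewrite !inE eqxx.
Qed.

(** The map [pblock P] sends the vertices onto [P]; equal cardinalities make it injective, so that
    no block holds two vertices. *)
Lemma partition_card_le P :
  partition P [set: G] -> #|P| <= #|G| ?= iff (P == singletons).
Proof.
case/and3P => /eqP covP tP nP.
have imP : pblock P @: G = P.
  apply/setP => A; apply/imsetP/idP => [[x _ ->]|AP].
    by apply: pblock_mem; rewrite covP.
  have [A0|[x xA]] := set_0Vmem A; first by rewrite -A0 AP in nP.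
  by exists x => //; rewrite (def_pblock tP AP xA).
have leP : #|P| <= #|G| by rewrite -[in X in X <= _]imP leq_imset_card.
split=> //; apply/eqP/eqP => [cP|->]; last exact: card_singletons.
have inj : {in G &, injective (pblock P)} by apply/imset_injP/eqP; rewrite imP.
apply/eqP; rewrite eqEcard card_singletons cP leqnn andbT.
apply/subsetP => A AP.
have [A0|[x xA]] := set_0Vmem A; first by rewrite -A0 AP in nP.
apply/imsetP; exists x => //; apply/setP => y; rewrite inE.
apply/idP/eqP => [yA|->//]; apply: inj => //.
by rewrite (def_pblock tP AP xA) (def_pblock tP AP yA).
Qed.

Lemma PRC_singletons :
  0 < #|G| -> PRC G = #|G| <-> prc_partition singletons.
Proof.
move=> G0; split=> [PG|prcS].
  (* Otherwise every prc-partition differs from [singletons], hence has fewer than [#|G|] blocks,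
     and so does the maximum. *)
  apply: contraT => nS; suff: PRC G <= #|G|.-1 by rewrite PG -ltnS prednK ?ltnn.
  apply/bigmax_leqP => P prcP; rewrite -ltnS prednK //.
  have /andP[parP _] := prcP.
  rewrite (ltn_leqif (partition_card_le parP)).
  by apply: contraNneq nS => <-.
apply/eqP; rewrite eqn_leq; apply/andP; split.
  by apply/bigmax_leqP => P /andP[parP _]; exact: (partition_card_le parP).
by rewrite -card_singletons (bigmax_sup singletons).
Qed.

Lemma prc_partition_singletons :
  prc_partition singletons <->
  forall x, universal x \/ exists y, coalition x y.
Proof.
rewrite /prc_partition partition_singletons /=; split=> [/forall_inP H x|H].
  have /H : [set x] \in singletons by rewrite imset_f.
  rewrite cards1 dominating1 /= => /orP[|]; first by left.
  case/exists_inP => _ /imsetP[y _ ->] /perfect_coalition1 c.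
  by right; exists y.
apply/forall_inP => _ /imsetP[x _ ->]; rewrite cards1 dominating1 /=.
case: (H x) => [->//|[y /perfect_coalition1 c]]; apply/orP; right.
by apply/exists_inP; exists [set y]; rewrite ?imset_f.
Qed.

(** * Bipartitions and opposite vertices *)

Section Sides.
Variable side : G -> bool.

Definition proper_side : Prop := forall x y, adj x y -> side x != side y.

(** Nothing is said about [x] and [y] themselves, so that [opposite] covers both a deleted matching
    edge and a kept edge between unmatched vertices. *)
Definition joined_except x y : Prop :=
  forall z, z != y -> side z != side x -> adj x z.

Definition opposite x y : Prop :=
  [/\ side x != side y, joined_except x y & joined_except y x].

(** The last clause stands for [r, s >= 2]; it also excludes universal vertices. *)
Definition paired : Prop :=
  [/\ proper_side, forall x, exists y, opposite x y
    & forall x, exists2 y, y != x & side y = side x].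

Lemma opposite_sym x y : opposite x y -> opposite y x.
Proof. by case=> ? ? ?; split=> //; rewrite eq_sym. Qed.

Hypothesis proper : proper_side.

Lemma same_side_nadj x y : side x = side y -> adj x y = false.
Proof. by move=> sxy; apply/negP => /proper; rewrite sxy eqxx. Qed.

(** A vertex across from [x] lies on the side of [y], so it is not adjacent to [y] and the coalition
    makes it adjacent to [x]. *)
Lemma coalition_opposite x y :
  coalition x y -> side x != side y -> opposite x y.
Proof.
have half u v : coalition u v -> side u != side v -> joined_except u v.
  move=> [uv _ _ H] suv z zv szu.
  have zu : z != u by apply: contraNneq szu => ->.
  have szv := bool_neq_trans szu suv.
  by have := H z zu zv; rewrite (same_side_nadj szv) addbF adj_sym.
move=> c sxy; split=> //; apply: half => //; first exact: coalition_sym.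
by rewrite eq_sym.
Qed.

Lemma opposite_paired :
  2 < #|G| -> (forall x, ~~ universal x) ->
  (forall x, exists y, opposite x y) -> paired.
Proof.
move=> G2 nuniv opp; split=> // x.
have [/existsP[y /andP[yx /eqP sy]]|] :=
  boolP [exists y, (y != x) && (side y == side x)]; first by exists y.
rewrite negb_exists => /forallP alone.
have {}alone y : y != x -> side y != side x.
  by move=> yx; have := alone y; rewrite yx.
(* If [x] is alone on its side, it is the only possible opposite of every other vertex. Applied to
   two such vertices, this makes [x] universal. *)
have joinx u : u != x -> joined_except x u.
  move=> ux; have [w [suw _ jw]] := opp u.
  have [<-//|wx] := eqVneq w x.
  case/eqP: suw; apply: bool_neq_trans (alone u ux) _.
  by rewrite eq_sym alone.
have [u] := fresh (s := [:: x]) (ltnW G2); rewrite inE => ux.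
have [v] := fresh (s := [:: x; u]) G2; rewrite !inE negb_or => /andP[vx vu].
case/forall_inP: (nuniv x) => y yx.
have [->|yu] := eqVneq y u; last exact: joinx ux y yu (alone y yx).
by apply: (joinx v vx) (alone u ux); rewrite eq_sym.
Qed.

(* The side of u must be {u, y}, and every vertex other than x across from u
   is adjacent to y, hence not to u; this leaves only one such vertex b. *)
Lemma same_side_opposite x y u v :
  3 < #|G| -> (forall z, exists w, coalition z w) ->
  opposite x y -> coalition u v -> side u = side v -> side u = side y ->
  exists w, opposite u w.
Proof.
move=> G3 coal oxy cuv suv suy; have [uv _ _ H] := cuv.
(* A third vertex on this side would be adjacent to neither [u] nor [v]. *)
have only w : side w = side u -> w = u \/ w = v.
  move=> swu; have [|wu] := eqVneq w u; first by left.
  have [|wv] := eqVneq w v; first by right.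
  by have := H w wu wv; rewrite !same_side_nadj // swu.
case: (only y) => [//|yu|yv].
  by exists x; rewrite -yu; apply: opposite_sym.
subst v; have [sxy jx jy] := oxy.
have axu : adj x u by rewrite jx // suv eq_sym.
have nadj w : w != x -> side w != side y -> adj w u = false.
  move=> wx swy; have wu : w != u by apply: contraNneq swy => ->; rewrite suy.
  have wy : w != y by apply: contraNneq swy => ->.
  by have := H w wu wy; rewrite [adj w y]adj_sym jy // addbT => /negbTE.
(* The fourth vertex comes from the order being at least 4; it lies across from [u], whose side is
   full. *)
have [b] := fresh (s := [:: x; u; y]) G3.
rewrite !inE !negb_or => /and3P[bx bu by_].
have sbu : side b != side u.
  by apply/eqP => /only[] /eqP; [rewrite (negbTE bu)|rewrite (negbTE by_)].
have nbu : adj b u = false by rewrite nadj // -suy.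
(* If the partner [c] of [b] is across, it is [u], which settles the claim, or [y], which would
   force [b] adjacent to [u]. If it is on the side of [b], it must be [x], since [u] is adjacent to
   one of [b] and [c]. *)
have [c cbc] := coal b; have [bc _ _ Hb] := cbc.
have [sbc|sbc] := eqVneq (side b) (side c); last first.
  have obc := coalition_opposite cbc sbc.
  case: (only c) => [|cu|cy].
  - by apply: (bool_neq_trans (b := side b)) => //; rewrite eq_sym.
  - by exists b; rewrite -cu; apply: opposite_sym.
  - by case: obc => _ jb _; move: nbu; rewrite jb // ?cy // eq_sym.
have cx : c = x.
  apply/eqP; apply: contraT => cx.
  have ub : u != b by rewrite eq_sym.
  have uc : u != c by apply: contraNneq sbu => ->; rewrite sbc.
  have := Hb u ub uc.
  by rewrite ![adj u _]adj_sym nbu nadj // -sbc -suy.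
(* Now the sides are [{u, y}] and [{b, x}], with [x] adjacent to [u] and [b] adjacent to [y]. *)
subst c; exists b; split; first by rewrite eq_sym.
  move=> z zb szu; have [->|zx] := eqVneq z x; first by rewrite adj_sym.
  have szb : side z = side b by apply: bool_neq_trans szu _; rewrite eq_sym.
  have := Hb z zb zx.
  by rewrite (same_side_nadj szb) (same_side_nadj (etrans szb sbc)).
move=> z zu szb; case: (only z) => [|/eqP|->].
- by apply: bool_neq_trans szb sbu.
- by rewrite (negbTE zu).
- by rewrite adj_sym jy // -suy.
Qed.

End Sides.

(** An opposite vertex serves as partner: each further vertex is across from exactly one of the two
    and adjacent to that one. *)
Lemma paired_coalition (side : G -> bool) :
  paired side -> forall x, exists y, coalition x y.
Proof.
case=> proper opp two x; have [y [sxy jx jy]] := opp x; exists y.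
have same := same_side_nadj proper.
have nuniv u : ~~ universal u.
  have [v vu suv] := two u; apply/forall_inP => /(_ v vu).
  by rewrite same.
split=> // [|z zx zy]; first by apply: contraNneq sxy => ->.
have [szx|szx] := eqVneq (side z) (side x).
  by rewrite (same z x) // adj_sym jy // szx.
by rewrite (same z y) ?addbF 1?adj_sym ?jx //; apply: bool_neq_trans szx sxy.
Qed.

(** * Triangle-free graphs: from coalitions to a bipartition *)

Section TriangleFree.
Hypothesis triG : triangle_free G.
Hypothesis G3 : 3 < #|G|.

(** A universal [u] would be adjacent to both members of any coalition avoiding it, and it belongs
    to none. So any other [x] would be universal too, which yields a triangle. *)
Lemma coalition_not_universal :
  (forall x, universal x \/ exists y, coalition x y) ->
  forall x, exists y, coalition x y.
Proof.
move=> H u; case: (H u) => // uu; have /forall_inP adju := uu.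
have [x] := fresh (s := [:: u]) (ltnW (ltnW G3)); rewrite inE => xu.
have [z] := fresh (s := [:: u; x]) (ltnW G3).
rewrite !inE negb_or => /andP[zu zx].
case: (H x) => [/forall_inP adjx|[y [xy _ ny Hxy]]].
  by case: (triG (x := u) (y := x) (z := z)); rewrite !adju ?adjx.
have yu : y != u by apply: contraNneq ny => ->.
by have := Hxy u; rewrite !adju // ![u == _]eq_sym => /(_ xu yu).
Qed.

Lemma coalition_paired :
  (forall x, exists y, coalition x y) -> exists side, paired side.
Proof.
move=> coal.
have [x _] : exists x : G, x \notin [::] by apply: fresh; apply: leq_trans G3.
have [y cxy] := coal x; have [xy _ _ H] := cxy.
(* The true side is N(x) + y; the false one consists of [x] and vertices adjacent to [y]. An edge
   inside a side gives a triangle or a vertex adjacent to both [x] and [y]. *)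
pose side z := (z == y) || adj x z.
have sx : side x = false by rewrite /side adj_irr (negbTE xy).
have sy : side y by rewrite /side eqxx.
have nadjy u : adj x u -> adj y u = false.
  move=> xu; have ux : u != x by apply: contraTneq xu => ->; rewrite adj_irr.
  have [->|uy] := eqVneq u y; first exact: adj_irr.
  by have := H u ux uy; rewrite ![adj u _]adj_sym xu => /negbTE.
have adjy u : u != x -> ~~ side u -> adj y u.
  rewrite /side negb_or => ux /andP[uy /negbTE xu].
  by have := H u ux uy; rewrite ![adj u _]adj_sym xu.
have proper : proper_side side.
  move=> u v uv; apply/eqP => suv; have [su|su] := boolP (side u).
    have := su; have := su; rewrite {2}suv /side.
    case/orP=> [/eqP uy|xu] /orP[/eqP vy|xv].
    - by move: uv; rewrite uy vy adj_irr.
    - by move: uv; rewrite uy nadjy.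
    - by move: uv; rewrite vy adj_sym nadjy.
    - exact: (triG (And3 xu uv xv)).
  have sv : ~~ side v by rewrite -suv.
  have [ux|ux] := eqVneq u x.
    by move: sv; rewrite /side -ux uv orbT.
  have [vx|vx] := eqVneq v x.
    by move: su; rewrite /side -vx adj_sym uv orbT.
  exact: (triG (And3 (adjy _ ux su) uv (adjy _ vx sv))).
have oxy : opposite side x y by apply: coalition_opposite; rewrite ?sx ?sy.
exists side; apply: opposite_paired => // [|u|u]; first exact: ltnW.
  by have [v []] := coal u.
have [v cuv] := coal u.
have [suv|suv] := eqVneq (side u) (side v); last first.
  by exists v; apply: coalition_opposite.
(* The roles of [x] and [y] are swapped when [u] is on the side of [x]. *)
have [suy|suy] := eqVneq (side u) (side y).
  exact: (same_side_opposite proper G3 coal oxy cuv suv suy).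
apply: (same_side_opposite proper G3 coal (opposite_sym oxy) cuv suv).
by move: suy; rewrite sy sx; case: (side u).
Qed.

Lemma PRC_paired : PRC G = #|G| <-> exists side, paired side.
Proof.
have G0 : 0 < #|G| by apply: leq_trans G3.
split=> [/(PRC_singletons G0)/prc_partition_singletons|[side pG]].
  by move=> /coalition_not_universal/coalition_paired.
apply/(PRC_singletons G0)/prc_partition_singletons => x; right.
exact: paired_coalition pG x.
Qed.

End TriangleFree.

(** * Matchings *)

Section Matchings.
Variable M : {set {set G}}.
Hypothesis matM : matching M.

Lemma matching_inj x y z : [set x; y] \in M -> [set x; z] \in M -> y = z.
Proof.
case/andP: matM => _ /trivIsetP tM xyM xzM.
have E : [set x; y] = [set x; z].
  apply/eqP; apply: contraT => /(tM _ _ xyM xzM) /pred0P/(_ x).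
  by rewrite /= !inE eqxx.
have : y \in [set x; z] by rewrite -E !inE eqxx orbT.
rewrite !inE => /orP[/eqP yx|/eqP//].
have : z \in [set x; y] by rewrite E !inE eqxx orbT.
by rewrite yx !inE orbb => /eqP.
Qed.

Lemma matching_adj x y : [set x; y] \in M -> adj x y.
Proof.
case/andP: matM => /subsetP sM _ xyM; have /imsetP[[a b] /= ab E] := sM _ xyM.
rewrite inE /= in ab.
by case: (set2_inj E) => -[-> ->] //; rewrite adj_sym.
Qed.

Lemma matched_mate x : x \in cover M -> exists y, [set x; y] \in M.
Proof.
case/andP: matM => /subsetP sM _ /bigcupP[e eM].
have /imsetP[[a b] /= _ E] := sM _ eM; rewrite E in eM *.
case/set2P => ->; first by exists b.
by exists a; rewrite setUC.
Qed.

(** Each edge of [M] has exactly one end on each side; the count is summed over the disjoint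
    edges. *)
Lemma card_matched_side (side : G -> bool) b :
  proper_side side -> #|[set x in cover M | side x == b]| = #|M|.
Proof.
move=> proper; rewrite -!sum1_card.
under eq_bigl do rewrite inE.
have /andP[/subsetP sM tM] := matM.
rewrite big_trivIset_cond //; apply: eq_bigr => e /sM.
case/imsetP => -[u v] /=; rewrite inE /= => uv ->.
have := proper _ _ uv; rewrite big_mkcondr /= big_setU1 ?big_set1; last first.
  by rewrite inE; apply: contraTneq uv => ->; rewrite adj_irr.
by case: (side u); case: (side v); case: b.
Qed.

End Matchings.

End Coalitions.

Lemma isomorphic_paired (G H : sgraph) (side : H -> bool) :
  isomorphic G H -> paired side -> exists side' : G -> bool, paired side'.
Proof.
case=> f [g fK gK] adjf [proper opp two]; exists (side \o f); split=> /=.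
- by move=> x y; rewrite -adjf => /proper.
- move=> x; have [y [sxy jx jy]] := opp (f x); exists (g y).
  split; rewrite /joined_except /= ?gK // => z ne sz; rewrite -adjf.
    by rewrite jx //; apply: contraNneq ne => <-; rewrite fK.
  by rewrite gK jy //; apply: contraNneq ne => /(can_inj fK)->.
- move=> x; have [y yx sy] := two (f x); exists (g y); rewrite /= ?gK //.
  by apply: contraNneq yx => <-; rewrite gK.
Qed.

(** * Complete bipartite graphs minus a matching *)

Section CompleteBipartite.
Variables r s : nat.
Implicit Types (x y z : Krs r s) (M : {set {set Krs r s}}).

Definition left x : bool := if x is inl _ then true else false.

Lemma Krs_adj x y : adj x y = (left x != left y).
Proof. by case: x y => [i|i] [j|j]. Qed.

Lemma proper_left : proper_side left.
Proof. by move=> x y; rewrite Krs_adj. Qed.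

Lemma card_left b : #|[set x | left x == b]| = if b then r else s.
Proof.
case: b.
  have -> : [set x | left x == true] = [set inl i | i in 'I_r].
    apply/setP => -[i|j]; rewrite inE; first by rewrite imset_f.
    by apply/esym/imsetP => -[].
  by rewrite card_imset ?card_ord // => i j [].
have -> : [set x | left x == false] = [set inr j | j in 'I_s].
  apply/setP => -[i|j]; rewrite inE; last by rewrite imset_f.
  by apply/esym/imsetP => -[].
by rewrite card_imset ?card_ord // => i j [].
Qed.

(** As [#|M|] counts the matched vertices of side [b], strictness means that they form a proper
    subset of that side. *)
Lemma matching_lt_side M b : matching M ->
  (#|M| < if b then r else s) = [exists x, (left x == b) && (x \notin cover M)].
Proof.
move=> matM; rewrite -(card_matched_side matM b proper_left) -card_left.
have sub : [set x in cover M | left x == b] \subset [set x | left x == b].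
  by apply/subsetP => x; rewrite !inE => /andP[].
rewrite (ltn_leqif (subset_leqif_cards sub)).
apply/idP/existsP => [ne|[x /andP[sx xM]]].
  apply/existsP; apply: contraR ne; rewrite negb_exists => /forallP H.
  apply/eqP/setP => x; have := H x; rewrite !inE.
  by case: (_ == b); rewrite ?andbF // negbK => ->.
by apply/eqP => /setP/(_ x); rewrite !inE sx (negbTE xM).
Qed.

(** A conditional property: a perfect matching satisfies it vacuously. *)
Definition unmatched_both_sides M : Prop :=
  forall x, x \notin cover M -> exists2 y, y \notin cover M & left x != left y.

Lemma unmatched_both_sidesP M : matching M ->
  unmatched_both_sides M <-> perfect_matching M \/ #|M| < minn r s.
Proof.
move=> matM; rewrite /perfect_matching matM leq_min.
rewrite (matching_lt_side true) // (matching_lt_side false) //; split=> [H|].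
  have [->|] := eqVneq (cover M) setT; first by left.
  rewrite -subTset => /subsetPn[x _ xM]; right.
  have [y yM sxy] := H x xM.
  have unmatched z b : left z = b -> z \notin cover M ->
      [exists t, (left t == b) && (t \notin cover M)].
    by move=> zb zM; apply/existsP; exists z; rewrite zb eqxx.
  case sx: (left x) sxy; case sy: (left y) => // _; apply/andP; split.
  - exact: unmatched sx xM.
  - exact: unmatched sy yM.
  - exact: unmatched sy yM.
  - exact: unmatched sx xM.
case=> [/eqP covM x|]; first by rewrite covM inE.
case/andP=> /existsP[a /andP[/eqP sa aM]] /existsP[b /andP[/eqP sb bM]] x _.
by case sx: (left x); [exists b|exists a]; rewrite ?sa ?sb.
Qed.

Lemma perfect_matching_eq M : perfect_matching M -> r = s.
Proof.
case/andP => matM /eqP covM.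
have card b : #|M| = if b then r else s.
  rewrite -(card_matched_side matM b proper_left) -card_left covM.
  by apply: eq_card => x; rewrite !inE.
by rewrite -(card true) (card false).
Qed.

Lemma del_edges_adj M x y :
  @adj (del_edges M) x y = (left x != left y) && ([set x; y] \notin M).
Proof. by rewrite -Krs_adj. Qed.

Lemma paired_del_edges M :
  2 <= r -> 2 <= s -> matching M -> unmatched_both_sides M ->
  paired (G := del_edges M) left.
Proof.
move=> r2 s2 matM unM; split.
- by move=> x y; rewrite del_edges_adj => /andP[].
(* The opposite of a matched vertex is its mate; that of an unmatched one is any unmatched vertex
   across. *)
- move=> x; have [/(matched_mate matM)[y xyM]|xM] := boolP (x \in cover M).
    exists y; split.
    + by rewrite -Krs_adj (matching_adj matM xyM).
    + move=> z zy szx; rewrite del_edges_adj eq_sym szx /=.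
      by apply: contraNN zy => /(matching_inj matM xyM)->.
    + move=> z zx szy; rewrite del_edges_adj eq_sym szy /=.
      by apply: contraNN zx; rewrite setUC in xyM => /(matching_inj matM xyM)->.
  have unmatched z t : z \notin cover M -> [set z; t] \notin M.
    by apply: contraNN => ztM; apply/bigcupP; exists [set z; t]; rewrite ?set21.
  have [y yM sxy] := unM x xM; exists y.
  by split=> // z _ sz; rewrite del_edges_adj eq_sym sz /= unmatched.
- case=> [i|j].
    have [k] : exists k : 'I_r, k \notin [:: i].
      by apply: fresh; rewrite card_ord.
    by rewrite inE => ki; exists (inl k).
  have [k] : exists k : 'I_s, k \notin [:: j] by apply: fresh; rewrite card_ord.
  by rewrite inE => kj; exists (inr k).
Qed.

End CompleteBipartite.

(** * Recovering the deleted matching from a paired graph *)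

Section FromPaired.
Variables (G : sgraph) (side : G -> bool).
Hypothesis pairG : paired side.
Variables (r s : nat) (g : Krs r s -> G).
Hypothesis bij_g : bijective g.
Hypothesis side_g : forall x, side (g x) = left x.
Implicit Types x y z : Krs r s.

Definition missing_edges : {set {set Krs r s}} :=
  [set [set p.1; p.2] |
     p : Krs r s * Krs r s & adj p.1 p.2 && ~~ adj (g p.1) (g p.2)].

Lemma mem_missing_edges x y :
  ([set x; y] \in missing_edges) = adj x y && ~~ adj (g x) (g y).
Proof.
apply/imsetP/idP => [[[a b]]|xy]; last by exists (x, y); rewrite ?inE.
rewrite inE !Krs_adj /= => ab E.
by case: (set2_inj E) => -[-> ->] //; rewrite eq_sym adj_sym.
Qed.

(** Any vertex across from [g x] and not adjacent to it must be the opposite of [g x]. *)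
Lemma missing_unique x y z :
  [set x; y] \in missing_edges -> [set x; z] \in missing_edges -> y = z.
Proof.
rewrite !mem_missing_edges !Krs_adj => /andP[sxy nxy] /andP[sxz nxz].
have [_ opp _] := pairG; have [w [_ jw _]] := opp (g x).
have eqw t : left x != left t -> ~~ adj (g x) (g t) -> g t = w.
  move=> sxt; apply: contraNeq => tw.
  by rewrite jw // !side_g eq_sym.
by apply: (bij_inj bij_g); rewrite (eqw y sxy nxy) (eqw z sxz nxz).
Qed.

Lemma matching_missing_edges : matching missing_edges.
Proof.
apply/andP; split.
  apply/subsetP => e /imsetP[p adjp ->]; apply/imsetP; exists p => //.
  by move: adjp; rewrite !inE => /andP[].
have mate e x : e \in missing_edges -> x \in e -> exists y, e = [set x; y].
  case/imsetP=> -[a b] _ -> /set2P[] ->; first by exists b.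
  by exists a; rewrite setUC.
apply/trivIsetP => e e' eM e'M; apply: contraR => /pred0Pn[x /andP[/= xe xe']].
have [y ey] := mate e x eM xe; have [z ez] := mate e' x e'M xe'.
by rewrite ey ez in eM e'M *; rewrite (missing_unique eM e'M).
Qed.

(** Were the opposite of [g x] matched, its mate could only be [x], the one vertex it may miss. *)
Lemma unmatched_missing_edges : unmatched_both_sides missing_edges.
Proof.
have [_ opp _] := pairG; have [h gK hK] := bij_g.
move=> x xM; have [w [sxw _ jw]] := opp (g x).
rewrite -[w]hK !side_g in sxw; exists (h w) => //.
apply: contra xM => /(matched_mate matching_missing_edges)[z wzM].
suff -> : x = z by apply/bigcupP; exists [set h w; z]; rewrite ?set22.
apply: (bij_inj bij_g); apply/eqP; move: wzM.
rewrite mem_missing_edges Krs_adj hK => /andP[swz]; apply: contraNT => xz.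
by apply: jw; [rewrite eq_sym|rewrite -[w]hK !side_g eq_sym].
Qed.

Lemma isomorphic_missing_edges : isomorphic G (del_edges missing_edges).
Proof.
have [proper _ _] := pairG; have [h gK hK] := bij_g.
exists h; first by exists g.
move=> u v; rewrite del_edges_adj mem_missing_edges Krs_adj !hK -!side_g !hK.
rewrite negb_and !negbK; have := @proper u v.
by case: (adj u v) => [-> //|_]; rewrite ?orbT ?orbF ?andNb.
Qed.

End FromPaired.

Lemma paired_isomorphic (G : sgraph) (side : G -> bool) :
  0 < #|G| -> paired side ->
  exists r s (M : {set {set Krs r s}}),
    [/\ 2 <= r, 2 <= s, matching M, unmatched_both_sides M
      & isomorphic G (del_edges M)].
Proof.
move=> G0 pG; have [_ opp two] := pG.
pose S b := [set x | side x == b].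
have card2 b : 1 < #|S b|.
  have [x0 _] : exists x : G, x \notin [::] by apply: fresh.
  (* Both sides are inhabited, by [x0] and its opposite. *)
  have [x sx] : exists x, side x = b.
    have [y [sxy _ _]] := opp x0; have [|sb] := eqVneq (side x0) b.
      by exists x0.
    by exists y; apply: bool_neq_trans sb; rewrite eq_sym.
  have [y yx sy] := two x; apply/card_gt1P; exists x, y.
  by rewrite !inE sy sx eqxx eq_sym.
pose g (x : Krs #|S true| #|S false|) : G :=
  match x with inl i => enum_val i | inr j => enum_val j end.
have side_g x : side (g x) = left x.
  by case: x => i /=; have := enum_valP i; rewrite inE => /eqP.
have bij_g : bijective g.
  apply: inj_card_bij => [x y gxy|].
    have := congr1 side gxy; rewrite !side_g.
    by case: x y gxy => [i|i] [j|j] //= /enum_val_inj->.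
  (* Injectivity suffices because the two sides cover [G]. *)
  rewrite card_sum !card_ord -cardsUI.
  apply: leq_trans (leq_addr _ _); rewrite -cardsT subset_leq_card //.
  by apply/subsetP => x _; rewrite !inE; case: (side x).
exists #|S true|, #|S false|, (missing_edges g); split=> //.
- exact: (matching_missing_edges pG bij_g side_g).
- exact: (unmatched_missing_edges pG bij_g side_g).
- exact: (isomorphic_missing_edges pG bij_g side_g).
Qed.

(** * The two families *)

Lemma paired_families (G : sgraph) :
  0 < #|G| ->
  (exists side : G -> bool, paired side) <-> family_T1 G \/ family_T2 G.
Proof.
move=> G0; split=> [[side pG]|].
  have [r [s [M [r2 s2 matM /(unmatched_both_sidesP matM)[perM|ltM] isoG]]]] :=
    paired_isomorphic G0 pG.
    have rs := perfect_matching_eq perM; subst s.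
    by left; exists r, M.
  by right; exists r, s, M.
case=> [[r [M [r2 perM isoG]]]|[r [s [M [r2 s2 matM ltM isoG]]]]].
  have /andP[matM _] := perM; apply: isomorphic_paired isoG _.
  by apply: paired_del_edges => //; apply/unmatched_both_sidesP => //; left.
apply: isomorphic_paired isoG _.
by apply: paired_del_edges => //; apply/unmatched_both_sidesP => //; right.
Qed.

Theorem theorem4p6 (n : nat) (G : sgraph) (order_G : #|G| = n) (n_ge4 : 4 <= n)
    (G_trianglefree : triangle_free G) :
  PRC G = n <-> family_T1 G \/ family_T2 G.
Proof.
subst n; have G0 : 0 < #|G| by apply: leq_trans n_ge4.
exact: iff_trans (PRC_paired G_trianglefree n_ge4) (paired_families G0).
Qed.
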